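(* Let $1\le k_1<\cdots<k_r\le n$ be integers, $\mathbf{k}=(k_1,\ldots,k_r)$, and let $\mathbf c=(c_1,\ldots,c_n)\in\mathbb{C}^n$ satisfy $c_1=\cdots=c_{k_1}$, $c_{k_1+1}=\cdots=c_{k_2}$, $\ldots$, $c_{k_r+1}=\cdots=c_n$, with the values of different blocks distinct. Let $A$ be a generic real symmetric $n\times n$ matrix. Then the linear optimization problem $$\min/\max\ \operatorname{trace}(AS)\quad\text{subject to } S\in\mathrm{Fl}_{\mathbf c}(\mathbf k;n)$$ over the isospectral flag variety $\mathrm{Fl}_{\mathbf c}(\mathbf k;n)$ has exactly $\binom{n}{k_1,\,k_2-k_1,\,\ldots,\,n-k_r}$ complex critical points.
   Context: Let $X_0=\mathrm{diag}(c_1,\ldots,c_n)$. The isospectral model $\mathrm{Fl}_{\mathbf c}(\mathbf k;n)$ is the image of the map $\mathrm{SO}(n)\to\mathbb{C}^{n\times n}$, $Q\mapsto QX_0Q^T$, where $\mathrm{SO}(n)$ is the complex special orthogonal group $\{Q\in\mathbb{C}^{n\times n}: Q^TQ=\mathrm{Id}_n,\det Q=1\}$; it is a smooth affine variety inside the space of complex symmetric matrices. A critical point of a regular function $f$ on a smooth affine variety $W$ is a point $p\in W$ at which the differential of $f$ vanishes on $T_pW$. $\binom{n}{m_1,\ldots,m_s}=\frac{n!}{m_1!\cdots m_s!}$ is the multinomial coefficient. ''Generic'' means: for all $A$ outside some proper Zariski closed subset of the space of symmetric matrices. *)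

(* Defs.v *)
From HB Require Import structures.
From mathcomp Require Import all_boot all_order all_algebra.
From mathcomp Require Import reals complex mpoly.

Set Implicit Arguments.
Unset Strict Implicit.
Unset Printing Implicit Defensive.

Import Order.TTheory GRing.Theory Num.Theory.

Local Open Scope ring_scope.

Section AffineVarieties.
Variables (K : fieldType) (n : nat).
Implicit Types (W : 'M[K]_n -> Prop) (F g : {mpoly K[n * n]}).

(* Polynomial functions on n x n matrices: the n * n variables are the matrix
   entries, in the order of mxvec. *)
Definition mxeval F (S : 'M[K]_n) : K := F.@[fun i => mxvec S 0 i].

Definition mxdiff F (S V : 'M[K]_n) : K :=
  \sum_(i < n * n) (F^`M(i)).@[fun j => mxvec S 0 j] * mxvec V 0 i.

Definition vanishing_ideal W g : Prop := forall S, W S -> mxeval g S = 0.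

Definition tangent_space W (S V : 'M[K]_n) : Prop :=
  forall g, vanishing_ideal W g -> mxdiff g S V = 0.

Definition represents W F (f : 'M[K]_n -> K) : Prop :=
  forall S, W S -> mxeval F S = f S.

(* Two polynomials representing f on W differ by an element of the vanishing
   ideal of W, so the condition does not depend on the choice of F. *)
Definition critical_point W (f : 'M[K]_n -> K) (S : 'M[K]_n) : Prop :=
  W S /\ exists F, represents W F f /\
                   forall V, tangent_space W S V -> mxdiff F S V = 0.

Definition special_orthogonal (Q : 'M[K]_n) : Prop :=
  Q^T *m Q = 1%:M /\ \det Q = 1.

Definition isospectral (c : 'rV[K]_n) (S : 'M[K]_n) : Prop :=
  exists Q, special_orthogonal Q /\ S = Q *m diag_mx c *m Q^T.

Definition symmetric_mx (A : 'M[K]_n) : Prop := A^T = A.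

Definition sym_zariski_closed (Z : 'M[K]_n -> Prop) : Prop :=
  exists I : {mpoly K[n * n]} -> Prop,
    forall A, Z A <-> symmetric_mx A /\ forall g, I g -> mxeval g A = 0.

Definition for_generic_sym (P : 'M[K]_n -> Prop) : Prop :=
  exists Z : 'M[K]_n -> Prop,
    [/\ sym_zariski_closed Z,
        exists A, symmetric_mx A /\ ~ Z A &
        forall A, symmetric_mx A -> ~ Z A -> P A].

End AffineVarieties.

(* Number of k_j with k_j <= i. Indices start at 0, so i < n stands for the
   coordinate c_(i+1), which lies in the block k_j < i + 1 <= k_(j+1). *)
Definition block (k : seq nat) (i : nat) : nat := count (fun m => m <= i)%N k.

(* [:: k_1; k_2 - k_1; ...; n - k_r] *)
Definition block_sizes (k : seq nat) (n : nat) : seq nat :=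
  pairmap (fun a b => b - a)%N 0%N (rcons k n).

Definition multinomial (n : nat) (m : seq nat) : nat :=
  (n`! %/ \prod_(a <- m) a`!)%N.

Definition has_exactly (T : eqType) (N : nat) (P : T -> Prop) : Prop :=
  exists s : seq T, [/\ uniq s, size s = N & forall x, x \in s <-> P x].

(* Main.v *)
Require Import Defs.
From HB Require Import structures.
From mathcomp Require Import all_boot all_order all_algebra.
From mathcomp Require Import reals complex mpoly.
From mathcomp Require Import all_fingroup ring.

Set Implicit Arguments.
Unset Strict Implicit.
Unset Printing Implicit Defensive.

Import Order.TTheory GRing.Theory Num.Theory.

Local Open Scope ring_scope.

(** The critical points are read off from a commutator equation.

    Let W be the orbit of diag c under conjugation by SO(n), and let A be symmetric.
    For skew O, the Cayley transform of t O is a rational curve in SO(n) through the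
    identity, so the matrices O S - S O are tangent to W at S
    ([tangent_isospectral]). If S is critical, the trace of A (O S - S O) vanishes
    for every skew O, which forces A S = S A ([critical_commute]).

    Suppose that A = P^T D P with P P^T = 1 and D diagonal with distinct entries. A
    point S of W that commutes with A is P^T diag(d) P, and comparing characteristic
    polynomials shows that d is a rearrangement of c. Every rearrangement occurs, and
    the resulting point is critical: for a row u of P, an eigenvector of S, a
    polynomial that has all c_i as roots, the eigenvalue of u being a simple one,
    yields an equation of W whose differential at S shows that u V u^T = 0 for all
    tangent V ([tangent_eigen]), and the trace of A V is a linear combination of these
    numbers. So the critical points
    are in bijection with the rearrangements of c ([critical_spectral_mxP]), and these
    are counted by the multinomial coefficient of the multiplicities, which are the
    block sizes ([multinomial_permutations]).

    The exceptional set is the zero locus of the determinant of the Krylov matrix with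
    rows w, w A, ..., w A^(n-1), where w is the all-ones row. A real symmetric matrix
    is diagonalisable, so a repeated eigenvalue makes this determinant vanish; for
    diag(0, ..., n-1) it is a Vandermonde determinant, hence nonzero. Distinct
    eigenvalues in turn give the orthogonal diagonalisation above
    ([simple_spectrum]).

    Differentials are formal derivatives of polynomials in the matrix entries. They
    are computed along rational curves through first-order expansions with a purely
    algebraic remainder, called jets. *)

(** * First-order jets of rational functions *)

Lemma poly_eq0_horner (K : numDomainType) (p : {poly K}) :
  (forall t, p.[t] = 0) -> p = 0.
Proof.
move=> p0; apply/eqP/negPn/negP => pN0.
have := @max_poly_roots _ p [seq i%:R | i <- iota 0 (size p)] pN0.
rewrite size_map size_iota ltnn => lt; suff: false by [].
apply: lt; first by apply/allP => x _; apply/rootP.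
by rewrite map_inj_uniq ?iota_uniq // => i j /eqP; rewrite eqr_nat => /eqP.
Qed.

(** The rules of [hornerE] without its simplification of products, which would
    reassociate them and leave terms that [ring] does not recognise. *)
Definition ringhornerE {K : comNzRingType} :=
  (@hornerD K, @hornerN K, @hornerM K, @horner_exp K, @hornerX K, @hornerC K).

Section Jets.
Variable K : numFieldType.
Implicit Types (f g : K -> K) (a b t : K).

(** [f t = a + b t + O(t^2)] at 0 for a rational function [f] regular at 0; the
    denominator [q] is kept in the equation, so that [f] may take any value at the
    zeros of [q], as [invmx] does at singular matrices. *)
Definition jet f a b := exists q r : {poly K}, q.[0] != 0 /\
  forall t, q.[t] != 0 -> q.[t] * f t = q.[t] * (a + b * t) + t ^+ 2 * r.[t].

Lemma jet_ext f g a b : f =1 g -> jet f a b -> jet g a b.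
Proof. by move=> fg [q [r [q0 h]]]; exists q, r; split=> // t /h; rewrite fg. Qed.

Lemma jet_affine a b : jet (fun t => a + b * t) a b.
Proof.
exists 1, 0; rewrite !hornerE oner_neq0; split=> // t _.
by rewrite !hornerE; ring.
Qed.

Lemma jet_cst a : jet (fun=> a) a 0.
Proof. by apply: jet_ext (jet_affine a 0) => t; ring. Qed.

Lemma jetD f g a b a' b' :
  jet f a b -> jet g a' b' -> jet (fun t => f t + g t) (a + a') (b + b').
Proof.
move=> [q [r [q0 h]]] [q' [r' [q'0 h']]]; exists (q * q'), (r * q' + r' * q).
split=> [|t]; rewrite !ringhornerE; first by rewrite mulf_neq0.
rewrite mulf_eq0 negb_or => /andP[/h e /h' e'].
transitivity (q'.[t] * (q.[t] * f t) + q.[t] * (q'.[t] * g t)); first by ring.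
by rewrite e e'; ring.
Qed.

Lemma jetM f g a b a' b' : jet f a b -> jet g a' b' ->
  jet (fun t => f t * g t) (a * a') (b * a' + a * b').
Proof.
move=> [q [r [q0 h]]] [q' [r' [q'0 h']]]; exists (q * q').
exists (q * q' * (b * b')%:P + r * q' * (a'%:P + b'%:P * 'X)
        + r' * q * (a%:P + b%:P * 'X) + 'X ^+ 2 * r * r').
split=> [|t]; rewrite !ringhornerE; first by rewrite mulf_neq0.
rewrite mulf_eq0 negb_or => /andP[/h e /h' e'].
transitivity ((q.[t] * f t) * (q'.[t] * g t)); first by ring.
by rewrite e e'; ring.
Qed.

Lemma jet_sum (I : finType) (f : I -> K -> K) (a b : I -> K) :
  (forall i, jet (f i) (a i) (b i)) ->
  jet (fun t => \sum_i f i t) (\sum_i a i) (\sum_i b i).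
Proof.
move=> h; elim: (index_enum I) => [|i s IH].
  by rewrite !big_nil; apply: jet_ext (jet_cst 0) => t; rewrite big_nil.
by rewrite !big_cons; apply: jet_ext (jetD (h i) IH) => t; rewrite big_cons.
Qed.

(** Clearing denominators turns the two expansions into one polynomial identity,
    valid away from the zeros of [d]; multiplying by the denominators makes it
    valid everywhere, and its two lowest coefficients are compared at 0. *)
Lemma jet_unique f g a b a' b' (d : {poly K}) :
    d.[0] != 0 -> (forall t, d.[t] != 0 -> f t = g t) ->
  jet f a b -> jet g a' b' -> a = a' /\ b = b'.
Proof.
move=> d0 fg [q [r [q0 h]]] [q' [r' [q'0 h']]].
pose D := d * q * q'; have D0 : D.[0] != 0 by rewrite !ringhornerE !mulf_neq0.
pose s := d * (r * q' - r' * q).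
pose E := D * (D * ((a - a')%:P + (b - b')%:P * 'X) + 'X ^+ 2 * s).
have E0 : E = 0.
  apply: poly_eq0_horner => t; rewrite hornerM.
  have [->|Dt] := eqVneq D.[t] 0; first by rewrite mul0r.
  have : (d.[t] != 0) && (q.[t] != 0) && (q'.[t] != 0).
    by move: Dt; rewrite !ringhornerE !mulf_eq0 !negb_or.
  case/andP => /andP[/fg e /h e1 /h' e2]; rewrite !ringhornerE.
  have -> : d.[t] * q.[t] * q'.[t] * (a - a' + (b - b') * t) +
     t ^+ 2 * (d.[t] * (r.[t] * q'.[t] - r'.[t] * q.[t])) =
     d.[t] * q'.[t] * (q.[t] * (a + b * t) + t ^+ 2 * r.[t]) -
     d.[t] * q.[t] * (q'.[t] * (a' + b' * t) + t ^+ 2 * r'.[t]) by ring.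
  by rewrite -e1 -e2 e; ring.
have DN0 : D != 0 by apply: contraNneq D0 => ->; rewrite horner0.
have {E0} : D * ((a - a')%:P + (b - b')%:P * 'X) + 'X ^+ 2 * s = 0.
  by move/eqP: E0; rewrite mulf_eq0 (negPf DN0) => /eqP.
move=> e; have aa : a = a'.
  move: (congr1 (horner^~ 0) e); rewrite /= horner0.
  rewrite !ringhornerE !mul0r mulr0 !addr0.
  move/eqP; rewrite -!hornerM -/D.
  by rewrite mulf_eq0 (negPf D0) subr_eq0 => /eqP.
split=> //.
have {e} : 'X * (D * (b - b')%:P + 'X * s) = 0.
  by rewrite -[RHS]e aa subrr; ring.
move/eqP; rewrite mulf_eq0 polyX_eq0 /= => /eqP /(congr1 (horner^~ 0)).
rewrite /= horner0 !ringhornerE mul0r addr0.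
move/eqP; rewrite -!hornerM -/D.
by rewrite mulf_eq0 (negPf D0) subr_eq0 => /eqP.
Qed.

(** The chain rule, by induction on the construction of [F]. *)
Lemma jet_mpoly n (F : {mpoly K[n]}) (v : 'I_n -> K -> K) (x y : 'I_n -> K) :
    (forall i, jet (v i) (x i) (y i)) ->
  jet (fun t => F.@[v^~ t]) F.@[x] (\sum_i (F^`M(i)).@[x] * y i).
Proof.
move=> hv.
pose good (F : {mpoly K[n]}) :=
  jet (fun t => F.@[v^~ t]) F.@[x] (\sum_i (F^`M(i)).@[x] * y i).
have goodC c : good c%:MP.
  have -> : good c%:MP = jet (fun t => c%:MP.@[v^~ t]) c 0.
    by rewrite /good mevalC big1 // => i _; rewrite mderivC meval0 mul0r.
  by apply: jet_ext (jet_cst c) => t; rewrite mevalC.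
have goodD G H : good G -> good H -> good (G + H).
  rewrite /good => /jetD hD /hD.
  have -> : \sum_i (G^`M(i)).@[x] * y i + \sum_i (H^`M(i)).@[x] * y i
    = \sum_i ((G + H)^`M(i)).@[x] * y i.
    by rewrite -big_split; apply: eq_bigr => i _; rewrite mderivD mevalD mulrDl.
  rewrite mevalD.
  by apply: jet_ext => t; rewrite mevalD.
have goodM G H : good G -> good H -> good (G * H).
  rewrite /good => /jetM hM /hM.
  have -> : (\sum_i (G^`M(i)).@[x] * y i) * H.@[x]
      + G.@[x] * (\sum_i (H^`M(i)).@[x] * y i)
    = \sum_i ((G * H)^`M(i)).@[x] * y i.
    rewrite mulr_suml mulr_sumr -big_split; apply: eq_bigr => i _ /=.
    by rewrite mderivM mevalD !mevalM; ring.
  rewrite mevalM.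
  by apply: jet_ext => t; rewrite mevalM.
have goodX i : good 'X_i.
  rewrite /good mevalXU (bigD1 i) //= big1 ?addr0 => [|j ji].
    rewrite mderivX mnm1E eqxx scale1r -[X in (X - _)%MM]add0m addmK mpolyX0.
    rewrite meval1 mul1r.
    by apply: jet_ext (hv i) => t; rewrite mevalXU.
  by rewrite mderivX mnm1E eq_sym (negPf ji) scale0r meval0 mul0r.
have good1 : good 1 by rewrite -mpolyC1; apply: goodC.
rewrite -/(good F); elim/mpolyind: F => [|c m p _ _ IH].
  by rewrite -mpolyC0; apply: goodC.
apply: goodD IH; rewrite -mul_mpolyC; apply: (goodM) => //.
rewrite mpolyXE_id; elim/big_rec: _ => // i G _ hG; apply: (goodM _ _ _ hG).
by elim: (m i) => [|k IH]; rewrite ?expr0 // exprS; exact: (goodM).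
Qed.

Definition mxjet m n (M : K -> 'M[K]_(m, n)) (M0 M1 : 'M_(m, n)) :=
  forall i j, jet (fun t => M t i j) (M0 i j) (M1 i j).

Lemma mxjet_cst m n (A : 'M[K]_(m, n)) : mxjet (fun=> A) A 0.
Proof. by move=> i j; rewrite mxE; apply: jet_cst. Qed.

Lemma mxjet_affine m n (A B : 'M[K]_(m, n)) : mxjet (fun t => A + t *: B) A B.
Proof.
by move=> i j; apply: jet_ext (jet_affine _ _) => t; rewrite !mxE [t * _]mulrC.
Qed.

Lemma mxjetM m n p (M : K -> 'M[K]_(m, n)) (N : K -> 'M[K]_(n, p)) M0 M1 N0 N1 :
    mxjet M M0 M1 -> mxjet N N0 N1 ->
  mxjet (fun t => M t *m N t) (M0 *m N0) (M1 *m N0 + M0 *m N1).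
Proof.
move=> hM hN i j; rewrite !mxE -big_split /=.
apply: (@jet_ext (fun t => \sum_k M t i k * N t k j)) => [t|]; first by rewrite mxE.
by apply: jet_sum => k; apply: jetM.
Qed.

Lemma mxjet_tr m n (M : K -> 'M[K]_(m, n)) M0 M1 :
  mxjet M M0 M1 -> mxjet (fun t => (M t)^T) M0^T M1^T.
Proof. by move=> h i j; rewrite !mxE; apply: jet_ext (h j i) => t; rewrite mxE. Qed.

Lemma jet_mxeval n (F : {mpoly K[n * n]}) (M : K -> 'M[K]_n) S V :
  mxjet M S V -> jet (fun t => mxeval F (M t)) (mxeval F S) (mxdiff F S V).
Proof.
move=> h; apply: jet_mpoly => i.
case/mxvec_indexP: i => i j; rewrite !mxvecE.
by apply: jet_ext (h i j) => t; rewrite mxvecE.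
Qed.

Definition cayley_den n (O : 'M[K]_n) : {poly K} :=
  \det (1%:M - 'X *: map_mx polyC O).

Lemma eval_cayley_den_mx n (O : 'M[K]_n) t :
  map_mx (horner_eval t) (1%:M - 'X *: map_mx polyC O) = 1%:M - t *: O.
Proof.
apply/matrixP => i j; rewrite !mxE /horner_eval !hornerE.
by case: (i == j); rewrite ?hornerE ?hornerMn /= ?hornerC.
Qed.

Lemma horner_cayley_den n (O : 'M[K]_n) t :
  (cayley_den O).[t] = \det (1%:M - t *: O).
Proof. by rewrite -eval_cayley_den_mx det_map_mx. Qed.

Lemma cayley_den0 n (O : 'M[K]_n) : (cayley_den O).[0] != 0.
Proof. by rewrite horner_cayley_den scale0r subr0 det1 oner_neq0. Qed.

Definition cayley n (O : 'M[K]_n) t := (1%:M + t *: O) *m invmx (1%:M - t *: O).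

(** Multiplied by its determinant, the inverse of [1 - t O] is the adjugate
    matrix, which is polynomial in [t]; and
    [(1 - t O)^-1 = 1 + t O + t^2 O^2 (1 - t O)^-1]. *)
Lemma mxjet_cayley n (O : 'M[K]_n) : mxjet (cayley O) 1%:M (O + O).
Proof.
suff inv : mxjet (fun t => invmx (1%:M - t *: O)) 1%:M O.
  by have := mxjetM (mxjet_affine 1%:M O) inv; rewrite !mulmx1 mul1mx.
pose N : 'M[{poly K}]_n := 1%:M - 'X *: map_mx polyC O.
move=> i j; exists (cayley_den O), ((map_mx polyC (O *m O) *m \adj N) i j).
split=> [|t]; first exact: cayley_den0.
rewrite horner_cayley_den => dN0; set D := 1%:M - t *: O.
have uD : D \in unitmx by rewrite unitmxE unitfE.
have adjE : \adj D = \det D *: invmx D.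
  by rewrite /invmx uD scalerA mulfV ?scale1r.
have -> : ((map_mx polyC (O *m O) *m \adj N) i j).[t] = (O *m O *m \adj D) i j.
  rewrite /D -eval_cayley_den_mx -map_mx_adj.
  have eO : map_mx (horner_eval t) (map_mx polyC (O *m O)) = O *m O.
    by apply/matrixP => k l; rewrite !mxE /horner_eval hornerC.
  by rewrite -[in RHS]eO -map_mxM [RHS]mxE.
have -> : (O *m O *m \adj D) i j = \det D * (O *m O *m invmx D) i j.
  by rewrite adjE -scalemxAr mxE.
have eI : invmx D = 1%:M + t *: O + t ^+ 2 *: (O *m O *m invmx D).
  have DO : O *m D = D *m O.
    by rewrite /D mulmxBl mulmxBr mul1mx mulmx1 -scalemxAl -scalemxAr.
  apply: (can_inj (mulKmx uD)); rewrite mulmxV // !mulmxDr -!scalemxAr.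
  rewrite 2!mulmxA -DO -[O *m D *m O]mulmxA -DO !mulmxA mulmxK //.
  rewrite mulmx1 /D mulmxBr mulmx1 -scalemxAr scalerBr scalerA.
  by rewrite addrA !subrK.
rewrite [in LHS]eI; move: (O *m O *m invmx D) => M; rewrite !mxE; ring.
Qed.
End Jets.

(** * Critical points of a linear form on the isospectral variety *)

Section Critical.
Variables (K : numFieldType) (n : nat).
Implicit Types (W : 'M[K]_n -> Prop) (S V A O Q : 'M[K]_n) (c : 'rV[K]_n).

(** Polynomial functions are handled through this existence statement, which passes
    to sums and products: the differential only depends on the values along curves,
    so the coefficients of the polynomial never matter. *)
Definition polyfun (f : 'M[K]_n -> K) :=
  exists F : {mpoly K[n * n]}, forall S, mxeval F S = f S.

Definition polymx p q (M : 'M[K]_n -> 'M[K]_(p, q)) :=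
  forall i j, polyfun (fun S => M S i j).

Lemma polyfun_sum (I : finType) (f : I -> 'M[K]_n -> K) :
  (forall i, polyfun (f i)) -> polyfun (fun S => \sum_i f i S).
Proof.
move=> h; elim: (index_enum I) => [|i s [G hG]].
  by exists 0 => S; rewrite /mxeval meval0 big_nil.
have [F hF] := h i; exists (F + G) => S; rewrite big_cons -hF -hG.
exact: mevalD.
Qed.

Lemma polymx_cst p q (B : 'M[K]_(p, q)) : polymx (fun=> B).
Proof. by move=> i j; exists (B i j)%:MP => S; apply: mevalC. Qed.

Lemma polymx_id : polymx (fun S => S).
Proof.
move=> i j; exists 'X_(mxvec_index i j) => S.
by rewrite /mxeval mevalXU mxvecE.
Qed.

Lemma polymxD p q (M N : 'M[K]_n -> 'M[K]_(p, q)) :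
  polymx M -> polymx N -> polymx (fun S => M S + N S).
Proof.
move=> hM hN i j; have [F hF] := hM i j; have [G hG] := hN i j.
by exists (F + G) => S; rewrite mxE -hF -hG; apply: mevalD.
Qed.

Lemma polymxM p q s (M : 'M[K]_n -> 'M[K]_(p, q)) (N : 'M[K]_n -> 'M[K]_(q, s)) :
  polymx M -> polymx N -> polymx (fun S => M S *m N S).
Proof.
move=> hM hN i j.
have [|F hF] := @polyfun_sum _ (fun k S => M S i k * N S k j).
  move=> k; have [F hF] := hM i k; have [G hG] := hN k j.
  by exists (F * G) => S; rewrite -hF -hG; apply: mevalM.
by exists F => S; rewrite hF mxE.
Qed.

Lemma polyfun_trace A : polyfun (fun S => \tr (A *m S)).
Proof.
by apply: polyfun_sum => i; apply: (polymxM (polymx_cst A) polymx_id).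
Qed.

(** Jets compute differentials without expanding [F]: it suffices to know the values
    of [F] along one curve with velocity [V]. *)
Lemma mxdiffE (F : {mpoly K[n * n]}) (M : K -> 'M[K]_n) S V a b :
  mxjet M S V -> jet (fun t => mxeval F (M t)) a b -> mxdiff F S V = b.
Proof.
move=> /(jet_mxeval F) h h'.
have [|//] := jet_unique (d := 1) _ (fun t _ => erefl) h h'.
by rewrite hornerC oner_neq0.
Qed.

Lemma mxdiffB (F G : {mpoly K[n * n]}) S V :
  mxdiff (F - G) S V = mxdiff F S V - mxdiff G S V.
Proof.
rewrite -sumrB; apply: eq_bigr => i _.
by rewrite mderivB mevalB mulrBl.
Qed.

(** An equation of [W] vanishes identically along the curve, so its jet is 0. *)
Lemma tangent_curve W S V (M : K -> 'M[K]_n) (d : {poly K}) :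
    mxjet M S V -> d.[0] != 0 -> (forall t, d.[t] != 0 -> W (M t)) ->
  tangent_space W S V.
Proof.
move=> hM d0 hW g hg.
have [|//] := jet_unique d0 _ (jet_mxeval g hM) (jet_cst 0).
by move=> t /hW /hg.
Qed.

(** Any polynomial that represents the trace form on [W] differs from the linear one
    by an equation of [W], which tangent vectors do not see. *)
Lemma critical_traceP W A S :
  critical_point W (fun S => \tr (A *m S)) S <->
  W S /\ forall V, tangent_space W S V -> \tr (A *m V) = 0.
Proof.
have [L hL] := polyfun_trace A.
have dL V : mxdiff L S V = \tr (A *m V).
  apply: (mxdiffE (mxjet_affine S V) (a := \tr (A *m S))).
  apply: jet_ext (jet_affine _ _) => t.
  by rewrite hL mulmxDr -scalemxAr linearD linearZ /= mulrC.
split=> [[WS [F [hF dF]]]|[WS h]]; split=> //.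
  move=> V tV; rewrite -dL; apply/eqP; rewrite -oppr_eq0 -[- _]add0r.
  rewrite -{1}(dF V tV) -mxdiffB; apply/eqP/tV => X WX.
  by rewrite /mxeval mevalB -!/(mxeval _ _) hF // hL subrr.
by exists L; split=> [X _|V /h]; rewrite ?hL ?dL.
Qed.

Lemma isospectral_sym c S : isospectral c S -> S^T = S.
Proof.
by case=> Q [_ ->]; rewrite !trmx_mul trmxK tr_diag_mx mulmxA.
Qed.

Lemma special_orthogonalM Q O :
  special_orthogonal Q -> special_orthogonal O -> special_orthogonal (Q *m O).
Proof.
move=> [QQ dQ] [OO dO]; split; last by rewrite det_mulmx dQ dO mulr1.
by rewrite trmx_mul mulmxA -[_ *m Q]mulmxA QQ mulmx1.
Qed.

Lemma isospectral_conj c S Q :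
  special_orthogonal Q -> isospectral c S -> isospectral c (Q *m S *m Q^T).
Proof.
move=> hQ [O [hO ->]]; exists (Q *m O); split; first exact: special_orthogonalM.
by rewrite trmx_mul !mulmxA.
Qed.

(** Transposition exchanges [1 + t O] and [1 - t O], hence their determinants agree
    and the inverse of their quotient is its transpose. *)
Lemma cayley_special_orthogonal O t : O^T = - O ->
  (cayley_den O).[t] != 0 -> special_orthogonal (cayley O t).
Proof.
rewrite horner_cayley_den /cayley => skew; set N := 1%:M - _; set P := 1%:M + _.
have NT : N^T = P by rewrite linearB linearZ /= skew trmx1 scalerN opprK.
have PT : P^T = N by rewrite -NT trmxK.
move=> dN; have uN : N \in unitmx by rewrite unitmxE unitfE.
have uP : P \in unitmx by rewrite -NT unitmx_tr.
have NP : N *m P = P *m N.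
  have -> : N = 1%:M + 1%:M - P by rewrite opprD addrA addrK.
  by rewrite mulmxBl mulmxBr mulmxDl mulmxDr mulmx1 mul1mx.
split; last first.
  by rewrite det_mulmx det_inv -NT det_tr mulfV.
rewrite trmx_mul trmx_inv NT PT mulmxA -[_ *m N *m P]mulmxA NP.
by rewrite mulmxA mulVmx // mul1mx mulmxV.
Qed.

(** Velocity of the curve [Q S Q^T], with [Q] the Cayley transform of [t O]; the
    factor two comes from the derivative of [Q] at 0. *)
Lemma tangent_isospectral c S O : isospectral c S -> O^T = - O ->
  tangent_space (isospectral c) S ((O + O) *m S - S *m (O + O)).
Proof.
move=> hS skew.
have := mxjetM (mxjetM (mxjet_cayley O) (mxjet_cst S)) (mxjet_tr (mxjet_cayley O)).
rewrite trmx1 mulmx1 mulmx0 addr0 mul1mx mulmx1 linearD /= skew -opprD mulmxN.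
move/tangent_curve; apply; first exact: (cayley_den0 O).
by move=> t /(cayley_special_orthogonal skew) hQ; apply: isospectral_conj.
Qed.

Lemma mxtrace_delta_mul (B : 'M[K]_n) k l : \tr (delta_mx k l *m B) = B l k.
Proof.
have E i j : (delta_mx k l *m B) i j = (i == k)%:R * B l j.
  rewrite mxE (bigD1 l) //= mxE eqxx andbT big1 ?addr0 // => m ml.
  by rewrite mxE (negPf ml) andbF mul0r.
rewrite /mxtrace (bigD1 k) //= E eqxx mul1r big1 ?addr0 // => i ik.
by rewrite E (negPf ik) mul0r.
Qed.

(** For skew [O] the derivative of the trace along [O S - S O] is
    [tr (O (S A - A S))]; taking for [O] the elementary skew matrices shows that
    the commutator, itself skew, vanishes. *)
Lemma critical_commute c A S : A^T = A ->
    critical_point (isospectral c) (fun S => \tr (A *m S)) S ->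
  A *m S = S *m A.
Proof.
move=> symA /critical_traceP[hS h]; have symS := isospectral_sym hS.
pose B := S *m A - A *m S; suff B0 : B = 0 by apply/esym/subr0_eq.
have skewB : B^T = - B.
  by rewrite linearB /= !trmx_mul symA symS opprB.
have trB O : O^T = - O -> \tr (O *m B) = 0.
  move=> skew; have := h _ (tangent_isospectral hS skew).
  have -> : \tr (A *m ((O + O) *m S - S *m (O + O))) = \tr (O *m B) *+ 2.
    rewrite mulr2n -linearD -mulmxDl /B !mulmxBr !linearB /=; congr (_ - _).
      by rewrite mxtrace_mulC mulmxA.
    by rewrite mulmxA mxtrace_mulC.
  by move/eqP; rewrite mulrn_eq0 /= => /eqP.
apply/matrixP => i j; rewrite [RHS]mxE.
have /trB : (delta_mx i j - delta_mx j i)^T =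
    - (delta_mx i j - delta_mx j i) :> 'M[K]_n.
  by rewrite linearB /= !trmx_delta opprB.
rewrite mulmxBl linearB /= !mxtrace_delta_mul.
have Bji : B j i = - B i j.
  by transitivity (B^T i j); [rewrite [RHS]mxE | rewrite skewB [LHS]mxE].
rewrite Bji => /eqP; rewrite -opprD oppr_eq0 -mulr2n mulrn_eq0 /=.
by move/eqP.
Qed.
End Critical.

(** * The critical points of a matrix with simple spectrum *)

Section SimpleSpectrum.
Variables (K : numFieldType) (n : nat).
Implicit Types (A S V P Q : 'M[K]_n) (c d D u : 'rV[K]_n).

Definition eval_prod (s : seq K) S : 'M[K]_n :=
  foldr (fun a M => (S - a%:M) *m M) 1%:M s.

Lemma polymx_shift a : polymx (fun S : 'M[K]_n => S - a%:M).
Proof. exact: (polymxD (@polymx_id K n) (@polymx_cst K n n n (- a%:M))). Qed.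

Lemma polymx_eval_prod s : polymx (eval_prod s).
Proof.
elim: s => [|a s IH] /=; first exact: polymx_cst.
exact: (polymxM (polymx_shift a) IH).
Qed.

Lemma mxjet_eval_prod s S V : exists B1,
  mxjet (fun t => eval_prod s (S + t *: V)) (eval_prod s S) B1.
Proof.
elim: s => [|a s [B1 IH]] /=; first by exists 0; apply: mxjet_cst.
exists (V *m eval_prod s S + (S - a%:M) *m B1); apply: mxjetM IH => i j.
by apply: jet_ext (mxjet_affine (S - a%:M) V i j) => t; rewrite addrAC.
Qed.

Lemma eval_prod_eigen s S (v : 'cV[K]_n) a :
  S *m v = a *: v -> eval_prod s S *m v = (\prod_(x <- s) (a - x)) *: v.
Proof.
move=> Sv; elim: s => [|x s IH] /=; first by rewrite big_nil mul1mx scale1r.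
rewrite -mulmxA IH -scalemxAr mulmxBl Sv mul_scalar_mx -scalerBl scalerA.
by rewrite big_cons mulrC.
Qed.

Lemma eval_prod_conj s S Q : Q^T *m Q = 1%:M ->
  eval_prod s (Q *m S *m Q^T) = Q *m eval_prod s S *m Q^T.
Proof.
move=> QQ; have QQ' := mulmx1C QQ.
elim: s => [|x s IH] /=; first by rewrite mulmx1.
rewrite IH; have -> : Q *m S *m Q^T - x%:M = Q *m (S - x%:M) *m Q^T.
  by rewrite mulmxBr mulmxBl mul_mx_scalar -scalemxAl QQ' scalemx1.
by rewrite !mulmxA -[_ *m Q^T *m Q]mulmxA QQ mulmx1.
Qed.

Lemma eval_prod_diag s c :
  eval_prod s (diag_mx c) = diag_mx (\row_i \prod_(x <- s) (c 0 i - x)).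
Proof.
elim: s => [|x s IH] /=.
  by apply/matrixP => i j; rewrite !mxE big_nil.
rewrite IH -diag_const_mx -linearB mulmx_diag; congr diag_mx.
by apply/rowP => i; rewrite !mxE big_cons.
Qed.

Definition entries d : seq K := [seq d 0 i | i <- enum 'I_n].

Lemma mem_entries d i : d 0 i \in entries d.
Proof. by apply: map_f; rewrite mem_enum. Qed.

(** Let [B(x)] be the product of the [x - c_i] with [c_i <> a]. As
    [(x - a) B(x)] vanishes at every [c_i], the polynomial [u (X - a) B(X) u^T]
    vanishes on the variety. Since [u (S - a) = 0] and [B(S) u^T] is a nonzero
    multiple of [u^T], its differential at [S] is a nonzero multiple of
    [u V u^T]. *)
Lemma tangent_eigen c S V u a : isospectral c S ->
    u *m S = a *: u -> a \in entries c ->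
    tangent_space (isospectral c) S V ->
  u *m V *m u^T = 0.
Proof.
move=> hS uS ac tV; have symS := isospectral_sym hS.
have Su : S *m u^T = a *: u^T by rewrite -{1}symS -trmx_mul uS linearZ.
(* Repeated values may stay in [s]; a repeated factor [X - a], however, would make
   the derivative vanish. *)
pose s := [seq x <- entries c | x != a].
pose f X := u *m (X - a%:M) *m eval_prod s X *m u^T.
have f_van X : isospectral c X -> f X = 0.
  case=> Q [[QQ _] ->]; have QQ' := mulmx1C QQ.
  rewrite /f -[u *m _ *m _]mulmxA.
  rewrite -[_ *m eval_prod s _]/(eval_prod (a :: s) (Q *m diag_mx c *m Q^T)).
  suff -> : eval_prod (a :: s) (Q *m diag_mx c *m Q^T) = 0.
    by rewrite mulmx0 mul0mx.
  rewrite eval_prod_conj // eval_prod_diag.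
  suff -> : (\row_i \prod_(x <- a :: s) (c 0 i - x)) = 0.
    by rewrite linear0 mulmx0 mul0mx.
  apply/rowP => i; rewrite !mxE; apply/eqP; rewrite prodf_seq_eq0.
  apply/hasP; exists (c 0 i); rewrite /= ?subrr // inE mem_filter mem_entries.
  by case: eqP.
have [F hF] : polyfun (fun X => f X 0 0).
  apply: (polymxM _ (polymx_cst _ u^T)); apply: (polymxM _ (polymx_eval_prod s)).
  exact: (polymxM (polymx_cst _ u) (polymx_shift a)).
have vF : vanishing_ideal (isospectral c) F.
  by move=> X hX; rewrite hF f_van // mxE.
have [B1 jB] := mxjet_eval_prod s S V.
have jA : mxjet (fun t => S + t *: V - a%:M) (S - a%:M) V.
  by move=> i j; apply: jet_ext (mxjet_affine (S - a%:M) V i j) => t; rewrite addrAC.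
have jf := mxjetM (mxjetM (mxjetM (mxjet_cst u) jA) jB) (mxjet_cst u^T).
have jF := @jet_ext K _ (fun t => mxeval F (S + t *: V)) _ _
  (fun t => esym (hF _)) (jf 0 0).
have := tV F vF; rewrite (mxdiffE (mxjet_affine S V) jF).
rewrite mul0mx add0r mulmx0 addr0 (_ : u *m (S - _) = 0); last first.
  by rewrite mulmxBr uS mul_mx_scalar subrr.
rewrite mul0mx addr0 -mulmxA (eval_prod_eigen _ Su) -scalemxAr mxE => /eqP.
rewrite mulf_eq0 prodf_seq_eq0 /= => /orP[/hasP[x]|/eqP e0].
  by rewrite mem_filter /= subr_eq0 eq_sym => /andP[/negP].
by apply/matrixP => i j; rewrite !ord1 e0 mxE.
Qed.

Lemma commute_diag_mx D S : injective (D 0) ->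
  diag_mx D *m S = S *m diag_mx D -> S = diag_mx (\row_i S i i).
Proof.
move=> D_inj DS; apply/matrixP => i j; rewrite !mxE.
have [->|ij] := eqVneq i j; first by [].
have := congr1 (fun X : 'M_n => X i j) DS; rewrite mul_diag_mx mul_mx_diag !mxE.
move/eqP; rewrite [S i j * _]mulrC -subr_eq0 -mulrBl mulf_eq0 subr_eq0.
by case/orP=> /eqP // /D_inj e; rewrite e eqxx in ij.
Qed.

Variables (P : 'M[K]_n) (D : 'rV[K]_n).
Hypothesis PP : P *m P^T = 1%:M.
Hypothesis D_inj : injective (D 0).
Let A := P^T *m diag_mx D *m P.
Let PP' : P^T *m P = 1%:M := mulmx1C PP.

(** The trace of [A V] is the sum of the [D_i] times the diagonal entries of
    [P V P^T]. *)
Lemma trace_simple_spectrum V :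
  (forall i, (P *m V *m P^T) i i = 0) -> \tr (A *m V) = 0.
Proof.
move=> h; rewrite /A -!mulmxA mxtrace_mulC -mulmxA.
by rewrite mul_diag_mx /mxtrace big1 // => i _; rewrite mxE h mulr0.
Qed.

Definition spectral_mx d := P^T *m diag_mx d *m P.

Lemma spectral_mx_inj : injective spectral_mx.
Proof.
move=> d e /(congr1 (fun X => P *m X *m P^T)).
rewrite /spectral_mx !mulmxA PP !mul1mx -!mulmxA PP !mulmx1 => /matrixP h.
by apply/rowP => i; have := h i i; rewrite !mxE eqxx.
Qed.

Lemma commute_spectral_mx S : A *m S = S *m A -> exists d, S = spectral_mx d.
Proof.
move=> AS; pose T := P *m S *m P^T.
have ST : S = P^T *m T *m P.
  by rewrite /T !mulmxA PP' mul1mx -mulmxA PP' mulmx1.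
have DT : diag_mx D *m T = T *m diag_mx D.
  have -> : diag_mx D = P *m A *m P^T.
    by rewrite /A !mulmxA PP mul1mx -mulmxA PP mulmx1.
  have conjM X Y : P *m X *m P^T *m (P *m Y *m P^T) = P *m (X *m Y) *m P^T.
    by rewrite !mulmxA -[_ *m P^T *m P]mulmxA PP' mulmx1.
  by rewrite /T !conjM AS.
exists (\row_i T i i).
by rewrite {1}ST {1}(commute_diag_mx D_inj DT).
Qed.

Lemma char_poly_conj Q X Q' : Q *m Q' = 1%:M ->
  char_poly (Q *m X *m Q') = char_poly X.
Proof.
move=> QQ; rewrite /char_poly.
have -> : char_poly_mx (Q *m X *m Q') =
    map_mx polyC Q *m char_poly_mx X *m map_mx polyC Q'.
  rewrite /char_poly_mx mulmxBr mulmxBl !map_mxM mul_mx_scalar -scalemxAl.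
  by rewrite -[map_mx _ Q *m map_mx _ Q']map_mxM QQ map_mx1 scalemx1.
rewrite !det_mulmx mulrAC -det_mulmx -map_mxM QQ map_mx1 det1; exact: mul1r.
Qed.

Lemma char_poly_diag d : char_poly (diag_mx d) = \prod_(x <- entries d) ('X - x%:P).
Proof.
rewrite char_poly_trig ?diag_mx_is_trig // big_map big_enum /=.
by apply: eq_bigr => i _; rewrite mxE eqxx.
Qed.

(** Conjugate matrices have the same characteristic polynomial, whose roots counted
    with multiplicity are the diagonal entries. *)
Lemma isospectral_entries c d :
  isospectral c (spectral_mx d) -> perm_eq (entries d) (entries c).
Proof.
case=> Q [[QQ _] e]; apply: prod_XsubC_eq; rewrite -!char_poly_diag.
rewrite -(char_poly_conj _ PP') -/(spectral_mx d) e.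
by rewrite (char_poly_conj _ (mulmx1C QQ)).
Qed.

(** [P^T] times a permutation matrix is orthogonal, of determinant 1 or -1; as signs
    commute with diagonal matrices, the determinant can be corrected by the sign of
    one column, which exists since [0 < n]. *)
Lemma entries_isospectral c d : (0 < n)%N ->
  perm_eq (entries d) (entries c) -> isospectral c (spectral_mx d).
Proof.
move=> n_gt0; rewrite /entries => /(@tuple_permP _ _ _ [tuple c 0 i | i < n]) [p ep].
have dE i : d 0 i = c 0 (p i).
  have := congr1 (fun s => nth 0 s i) ep; rewrite -tnth_nth.
  by rewrite (nth_map i) ?size_enum_ord // nth_ord_enum !tnth_mktuple.
have key : diag_mx d *m perm_mx p = perm_mx p *m diag_mx c.
  apply/matrixP => i j; rewrite mul_diag_mx mul_mx_diag !mxE dE.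
  by have [->|] := eqVneq (p i) j; rewrite ?mulr1 ?mul1r ?mulr0 ?mul0r.
pose Q0 := P^T *m perm_mx p.
have Q0Q0 : Q0^T *m Q0 = 1%:M.
  rewrite /Q0 trmx_mul trmxK mulmxA -[_ *m P *m P^T]mulmxA PP mulmx1.
  by rewrite tr_perm_mx -perm_mxM mulVg perm_mx1.
pose e : 'rV[K]_n := \row_i (if i == Ordinal n_gt0 then \det Q0 else 1).
have detQ0 : \det Q0 * \det Q0 = 1.
  by rewrite -{1}det_tr -det_mulmx Q0Q0 det1.
have ee : diag_mx e *m diag_mx e = 1%:M.
  rewrite mulmx_diag -diag_const_mx; congr diag_mx; apply/rowP => i.
  by rewrite !mxE; case: ifP; rewrite ?mulr1.
have det_e : \det (diag_mx e) = \det Q0.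
  rewrite det_diag (bigD1 (Ordinal n_gt0)) //= big1 ?mulr1 => [|i iN].
    by rewrite mxE eqxx.
  by rewrite mxE (negPf iN).
exists (Q0 *m diag_mx e); split; [split|].
- by rewrite trmx_mul tr_diag_mx mulmxA -[_ *m _ *m Q0]mulmxA Q0Q0 mulmx1 ee.
- by rewrite det_mulmx det_e detQ0.
rewrite trmx_mul tr_diag_mx !mulmxA -[Q0 *m _ *m diag_mx c]mulmxA.
rewrite diag_mxC mulmxA -[_ *m diag_mx e *m diag_mx e]mulmxA ee mulmx1.
rewrite /spectral_mx /Q0 trmx_mul trmxK !mulmxA; congr (_ *m _).
rewrite -[P^T *m _ *m _]mulmxA -key -!mulmxA; congr (_ *m _).
by rewrite tr_perm_mx -perm_mxM mulgV perm_mx1 mulmx1.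
Qed.

Lemma critical_spectral_mxP c S : (0 < n)%N ->
  critical_point (isospectral c) (fun S => \tr (A *m S)) S <->
  exists2 d, perm_eq (entries d) (entries c) & S = spectral_mx d.
Proof.
move=> n_gt0; split=> [crit|[d dc ->]].
  have [hS _] := crit; have symA : A^T = A.
    by rewrite /A !trmx_mul trmxK tr_diag_mx mulmxA.
  have [d Sd] := commute_spectral_mx (critical_commute symA crit).
  by exists d => //; apply: isospectral_entries; rewrite -Sd.
have hS := entries_isospectral n_gt0 dc; apply/critical_traceP; split=> // V tV.
apply: trace_simple_spectrum => i.
have e : row i P *m spectral_mx d = d 0 i *: row i P.
  rewrite /spectral_mx mulmxA mulmxA -row_mul PP row1.
  by rewrite -rowE row_diag_mx -scalemxAl -rowE.
have := tangent_eigen hS e _ tV; rewrite -(perm_mem dc) mem_entries.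
move=> /(_ isT) /matrixP /(_ 0 0); rewrite -row_mul tr_row.
by rewrite [RHS]mxE => <-; rewrite !mxE; apply: eq_bigr => j _; rewrite !mxE.
Qed.
End SimpleSpectrum.

(** * Counting the rearrangements of a sequence with repetitions *)

(** A nonempty rearrangement consists of a first entry [x] and a rearrangement of
    what remains; summing the induction hypothesis over [x] weights the factorial
    of [size s - 1] by the multiplicities of the [x], which add up to [size s]. *)
Lemma size_permutations_count (T : eqType) (s L : seq T) :
    uniq L -> {subset s <= L} ->
  (size (permutations s) * \prod_(x <- L) (count_mem x s)`! = (size s)`!)%N.
Proof.
move=> uL; have [m] := ubnP (size s); elim: m s => // m IH s.
move=> sm sL; have [/size0nil->|s_gt0] := posnP (size s); first by rewrite big1.
rewrite (perm_size (permutationsE s_gt0)).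
rewrite size_allpairs_dep sumnE big_map big_distrl /=.
have step x : x \in undup s -> (size (permutations (rem x s)) *
    \prod_(z <- L) (count_mem z s)`! = count_mem x s * (size s).-1`!)%N.
  rewrite mem_undup => xs; have xL := sL _ xs.
  have sr : size (rem x s) = (size s).-1 by rewrite size_rem.
  have rL : {subset rem x s <= L} by move=> z /mem_rem /sL.
  rewrite -[(size s).-1 in RHS]sr -(IH _ _ rL) ?sr ?prednK //.
  rewrite !(bigD1_seq x) //= [RHS]mulnCA; congr (_ * _)%N.
  have cx : count_mem x s = (count_mem x (rem x s)).+1.
    by have /seq.permP -> := perm_to_rem xs; rewrite /= eqxx.
  rewrite cx [RHS]mulnA -factS; congr (_ * _)%N.
  apply: eq_bigr => z zx; congr (_`!).
  by have /seq.permP -> := perm_to_rem xs; rewrite /= eq_sym (negPf zx).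
rewrite (eq_big_seq _ step) -big_distrl /= -[in RHS](prednK s_gt0) factS.
rewrite prednK //; congr (_ * _)%N.
rewrite -[RHS](perm_size (perm_count_undup s)) size_flatten sumnE /shape.
by rewrite -map_comp big_map; apply: eq_bigr => x _ /=; rewrite size_nseq.
Qed.

(** The multiplicities may be counted on labels [s] of the values, as long as distinct
    labels that occur have distinct values; labels in [L] that do not occur contribute
    factors [0! = 1]. *)
Lemma size_permutations_map (T U : eqType) (f : U -> T) (s L : seq U) :
    {in s &, injective f} -> uniq L -> {subset s <= L} ->
  (size (permutations (map f s)) * \prod_(x <- L) (count_mem x s)`! = (size s)`!)%N.
Proof.
move=> f_inj uL sL.
have -> : (\prod_(x <- L) (count_mem x s)`! =
           \prod_(x <- map f (undup s)) (count_mem x (map f s))`!)%N.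
  rewrite big_map (bigID (mem s)) /= [X in (_ * X)%N]big1 => [|x xs]; last first.
    by rewrite (count_memPn xs).
  rewrite muln1 -big_filter.
  have /(perm_big _) /= -> : perm_eq [seq x <- L | x \in s] (undup s).
    apply: uniq_perm; rewrite ?filter_uniq ?undup_uniq // => x.
    by rewrite mem_filter mem_undup andb_idr // => /sL.
  apply: eq_big_seq => x; rewrite mem_undup => xs; congr (_`!).
  rewrite count_map; apply: eq_in_count => y ys /=.
  by apply/eqP/eqP => [->|/f_inj->].
rewrite -(size_map f s); apply: size_permutations_count.
  rewrite map_inj_in_uniq ?undup_uniq // => x y; rewrite !mem_undup; exact: f_inj.
by move=> x; rewrite (eq_mem_map f (mem_undup s)).
Qed.

(** Generalised over the starting point [a], so that the first block can be split
    off: the indices from [a] to [m - 1] form block 0, and those from [m] on are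
    numbered as for the tail, shifted by one. The last block is empty when the last
    entry of [k] is [n]. *)
Lemma prod_block_sizes n k a : path leq a (rcons k n) ->
  (\prod_(b <- iota 0 (size k).+1)
     (count_mem b [seq block k i | i <- iota a (n - a)])`! =
   \prod_(m <- pairmap (fun a b => b - a) a (rcons k n)) m`!)%N.
Proof.
elim: k a => [|m k IH] a /=.
  rewrite andbT !big_cons !big_nil => an; congr (_`! * 1)%N.
  by rewrite count_map (eq_count (a2 := predT)) // count_predT size_iota.
case/andP=> am hp; have mn : (m <= n)%N.
  by have := order_path_min leq_trans hp; rewrite all_rcons => /andP[].
rewrite big_cons [RHS]big_cons.
have low i : i \in iota a (m - a) -> block (m :: k) i = 0.
  rewrite mem_iota subnKC // => /andP[_ im]; rewrite /block /= leqNgt im add0n.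
  apply/eqP; rewrite -leqn0 leqNgt -has_count; apply/hasPn => x xk.
  rewrite -ltnNge; apply: leq_trans im _.
  have := order_path_min leq_trans hp; rewrite all_rcons => /andP[_ /allP]; exact.
have high i : i \in iota m (n - m) -> block (m :: k) i = (block k i).+1.
  by rewrite mem_iota /block /= => /andP[-> _].
have -> : [seq block (m :: k) i | i <- iota a (n - a)] =
    nseq (m - a) 0%N ++ [seq b.+1 | b <- [seq block k i | i <- iota m (n - m)]].
  have -> : iota a (n - a) = iota a (m - a) ++ iota m (n - m).
    by rewrite -[X in iota X (n - m)](subnKC am) -iotaD addnC addnBA // subnK.
  rewrite map_cat; congr (_ ++ _); last by rewrite -map_comp; apply/eq_in_map.
  apply: (@eq_from_nth _ 0%N); rewrite size_map size_iota ?size_nseq // => i im.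
  rewrite nth_nseq im (nth_map 0%N) ?size_iota //; apply: low.
  by rewrite mem_nth // size_iota.
rewrite -IH //; congr (_ * _)%N.
  rewrite count_cat count_nseq count_map (eq_count (a2 := pred0)) // count_pred0.
  by rewrite mul1n addn0.
rewrite -[_ :: iota 2 _]/(iota (1 + 0) (size k).+1) iotaDl big_map.
apply: eq_bigr => b _; congr (_`!).
rewrite count_cat count_nseq mul0n add0n count_map; exact: eq_count.
Qed.

(** The values [c i] are labelled by the blocks: [f] sends a block to the common value
    of [c] on it. *)
Lemma multinomial_permutations (T : eqType) n (k : seq nat) (c : 'I_n -> T) :
    (0 < n)%N -> sorted ltn k -> (forall m, m \in k -> (m <= n)%N) ->
    (forall i j : 'I_n, block k i = block k j -> c i = c j) ->
    (forall i j : 'I_n, block k i <> block k j -> c i <> c j) ->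
  size (permutations [seq c i | i <- enum 'I_n]) = multinomial n (block_sizes k n).
Proof.
move=> n_gt0 k_sorted kn c_const c_distinct.
have k_path : path leq 0 (rcons k n).
  have : sorted leq k by apply: sub_sorted k_sorted => x y; apply: ltnW.
  case: (k) kn => [|m k'] //= kn kp; rewrite rcons_path kp /=.
  exact/kn/mem_last.
pose bl := [seq block k i | i <- iota 0 n].
have mem_bl i : (i < n)%N -> block k i \in bl.
  by move=> lt; apply: map_f; rewrite mem_iota.
pose f b := nth (c (Ordinal n_gt0)) [seq c i | i <- enum 'I_n] (index b bl).
have f_block (i : 'I_n) : f (block k i) = c i.
  have lt : (index (block k i) bl < n)%N.
    by rewrite -[X in (_ < X)%N](size_iota 0) -(size_map (block k)) index_mem mem_bl.
  rewrite /f (nth_map (Ordinal n_gt0)) ?size_enum_ord //; apply: c_const.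
  rewrite nth_enum_ord // -{2}(nth_index 0%N (mem_bl i (ltn_ord i))).
  by rewrite [in RHS](nth_map 0%N) ?size_iota // nth_iota.
have -> : [seq c i | i <- enum 'I_n] = map f bl.
  rewrite /bl -val_enum_ord -!map_comp; apply: eq_map => i /=.
  by rewrite f_block.
have f_inj : {in bl &, injective f}.
  move=> x y /mapP[i + ->] /mapP[j + ->]; rewrite !mem_iota /= => lti ltj.
  rewrite (f_block (Ordinal lti)) (f_block (Ordinal ltj)) => e.
  by apply/eqP/negPn/negP => /eqP /(c_distinct (Ordinal lti) (Ordinal ltj)).
have bl_sub : {subset bl <= iota 0 (size k).+1}.
  by move=> x /mapP[i _ ->]; rewrite mem_iota ltnS count_size.
have := size_permutations_map f_inj (iota_uniq _ _) bl_sub.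
have := prod_block_sizes k_path; rewrite subn0 -/bl => ->.
rewrite size_map size_iota /multinomial => <-; rewrite mulnK //.
by rewrite prodn_gt0 // => m; apply: fact_gt0.
Qed.

(** * Symmetric matrices with simple spectrum are generic *)

Section Krylov.
Variables (K : numFieldType) (n : nat).
Implicit Types (A P : 'M[K]_n) (d w : 'rV[K]_n).

Definition krylov_row w A m : 'rV[K]_n := iter m (mulmx^~ A) w.

(** The determinant of this matrix plays the role of the discriminant: for
    diagonalisable [A] and [w] with nonzero coordinates in an eigenbasis, it vanishes
    exactly when an eigenvalue is repeated, and it is visibly polynomial in [A]. *)
Definition krylov w A : 'M[K]_n := \matrix_(m < n) krylov_row w A m.

Lemma polyfun_prod (I : finType) (f : I -> 'M[K]_n -> K) :
  (forall i, polyfun (f i)) -> polyfun (fun S => \prod_i f i S).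
Proof.
move=> h; elim: (index_enum I) => [|i s [G hG]].
  by exists 1 => S; rewrite /mxeval meval1 big_nil.
have [F hF] := h i; exists (F * G) => S; rewrite big_cons -hF -hG.
exact: mevalM.
Qed.

Lemma polyfun_det (M : 'M[K]_n -> 'M[K]_n) :
  polymx M -> polyfun (fun S => \det (M S)).
Proof.
move=> hM; apply: polyfun_sum => s.
have [F hF] := polyfun_prod (fun i => hM i (s i)).
by exists (((-1) ^+ s)%:MP * F) => S; rewrite /mxeval mevalM mevalC -hF.
Qed.

Lemma polyfun_krylov w : polyfun (fun A => \det (krylov w A)).
Proof.
have poly_row m : polymx (fun A => krylov_row w A m).
  elim: m => [|m IH] /=; first exact: polymx_cst.
  exact: (polymxM IH (@polymx_id K n)).
apply: polyfun_det => i j; have [F hF] := poly_row i 0 j.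
by exists F => A; rewrite hF [in RHS]mxE.
Qed.

(** In an eigenbasis the rows of the Krylov matrix are the coordinates of [w] scaled by
    the powers of the eigenvalues. *)
Lemma krylov_conj w A d P : A = invmx P *m diag_mx d *m P -> P \in unitmx ->
  krylov w A = Vandermonde n d *m diag_mx (w *m invmx P) *m P.
Proof.
move=> -> uP; set v := w *m invmx P.
have rowE m : krylov_row w (invmx P *m diag_mx d *m P) m
    = (\row_j (d 0 j ^+ m * v 0 j)) *m P.
  elim: m => [|m IH] /=.
    have -> : \row_j (d 0 j ^+ 0 * v 0 j) = v.
      by apply/rowP => j; rewrite [LHS]mxE expr0 mul1r.
    by rewrite mulmxKV.
  rewrite IH !mulmxA mulmxK //; congr (_ *m P).
  by rewrite mul_mx_diag; apply/rowP => j; rewrite !mxE exprS; ring.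
apply/row_matrixP => m; rewrite rowK rowE row_mul; congr (_ *m P).
by rewrite mul_mx_diag; apply/rowP => j; rewrite !mxE.
Qed.

(** A repeated eigenvalue makes two columns of the Vandermonde factor equal. *)
Lemma det_krylov_simple w A d P : A = invmx P *m diag_mx d *m P -> P \in unitmx ->
  \det (krylov w A) != 0 -> injective (d 0).
Proof.
move=> eA uP; rewrite (krylov_conj w eA uP) !det_mulmx !mulf_eq0 !negb_or.
case/andP=> /andP[+ _ _]; rewrite det_Vandermonde => /prodf_neq0 dV.
have lt_neq (i j : 'I_n) : (i < j)%N -> d 0 i != d 0 j.
  by move=> ij; have /prodf_neq0/(_ j ij) := dV i isT; rewrite subr_eq0 eq_sym.
move=> i j eij; apply/val_inj; case: (ltngtP i j) => // /lt_neq; by rewrite eij eqxx.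
Qed.
End Krylov.

Lemma map_krylov (K L : numFieldType) (f : {rmorphism K -> L}) n w (A : 'M[K]_n) :
  map_mx f (krylov w A) = krylov (map_mx f w) (map_mx f A).
Proof.
apply/row_matrixP => m; rewrite -map_row !rowK.
by elim: (nat_of_ord m) => [|k IH] //=; rewrite map_mxM IH.
Qed.

Lemma det_krylov_neq0 (K : numFieldType) n :
  exists2 A : 'M[K]_n, A^T = A & \det (krylov (const_mx 1) A) != 0.
Proof.
pose d : 'rV[K]_n := \row_i i%:R; exists (diag_mx d); first exact: tr_diag_mx.
have e : diag_mx d = invmx 1%:M *m diag_mx d *m 1%:M.
  by rewrite invmx1 mulmx1 mul1mx.
rewrite (krylov_conj _ e) ?unitmx1 // invmx1 !mulmx1 diag_const_mx mulmx1.
rewrite det_Vandermonde; apply/prodf_neq0 => i _; apply/prodf_neq0 => j ij.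
by rewrite !mxE subr_eq0 eqr_nat; case: ltngtP ij.
Qed.

(** The spectral theorem provides a basis of eigenvectors, the rows of [P0]. As the
    eigenvalues are distinct and [A] is symmetric, these rows are orthogonal for the
    bilinear form too, so that [P0 P0^T] is diagonal; being invertible, it can be
    normalised to 1 by complex square roots. *)
Lemma simple_spectrum (R : realType) n (A : 'M[R]_n) (w : 'rV[R]_n) :
    A^T = A -> \det (krylov w A) != 0 ->
  exists P : 'M[R[i]]_n, exists d : 'rV[R[i]]_n,
    [/\ P *m P^T = 1%:M, injective (d 0) &
        map_mx (real_complex R) A = P^T *m diag_mx d *m P].
Proof.
move=> symA detA; set B := map_mx _ A.
have symB : B^T = B by rewrite /B map_trmx symA.
have detB : \det (krylov (map_mx (real_complex R) w) B) != 0.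
  by rewrite -map_krylov det_map_mx fmorph_eq0.
have normB : B \is normalmx.
  apply: symmetric_normalmx.
    by apply/is_hermitianmxP; rewrite expr0 scale1r map_mx_id // symB.
  by apply/mxOverP => i j; rewrite mxE complex_real.
move: (orthomx_spectralP normB) (spectral_unit B).
move: (spectralmx B) (spectral_diag B) => P0 d eB uP0.
have d_inj := det_krylov_simple eB uP0 detB.
have PB : P0 *m B = diag_mx d *m P0 by rewrite eB !mulmxA mulmxV ?mul1mx.
pose G := P0 *m P0^T.
have dG : diag_mx d *m G = G *m diag_mx d.
  have -> : G *m diag_mx d = P0 *m (diag_mx d *m P0)^T.
    by rewrite trmx_mul tr_diag_mx /G mulmxA.
  by rewrite -PB trmx_mul symB /G !mulmxA PB.
have uG : G \in unitmx by rewrite unitmx_mul unitmx_tr uP0.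
have [g eG] : exists g, G = diag_mx g.
  by exists (\row_i G i i); apply: commute_diag_mx d_inj dG.
have g_neq0 i : g 0 i != 0.
  move: uG; rewrite unitmxE unitfE eG det_diag => /prodf_neq0; exact.
pose e := \row_i (sqrtC (g 0 i))^-1; exists (diag_mx e *m P0), d.
have PP : diag_mx e *m P0 *m (diag_mx e *m P0)^T = 1%:M.
  rewrite trmx_mul tr_diag_mx mulmxA -[_ *m P0 *m P0^T]mulmxA -/G eG !mulmx_diag.
  rewrite -diag_const_mx; congr diag_mx; apply/rowP => i; rewrite !mxE.
  have s0 : sqrtC (g 0 i) != 0 by rewrite sqrtC_eq0.
  by rewrite -{2}[g 0 i]sqrtCK expr2 mulKf // mulfV.
have : diag_mx e *m P0 *m B = diag_mx d *m (diag_mx e *m P0).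
  by rewrite -mulmxA PB !mulmxA diag_mxC.
move: (diag_mx e *m P0) PP => P PP PB'; split; [exact: PP | exact: d_inj |].
by rewrite -mulmxA -PB' mulmxA (mulmx1C PP) mul1mx.
Qed.

Theorem theorem3p5 (R : realType) (n r : nat) (k : r.-tuple nat)
    (c : 'rV[R[i]]_n)
    (r_gt0 : (0 < r)%N)
    (k_bounds : forall m, m \in k -> (1 <= m <= n)%N)
    (k_increasing : sorted ltn k)
    (c_const : forall i j : 'I_n, block k i = block k j -> c 0 i = c 0 j)
    (c_distinct : forall i j : 'I_n, block k i <> block k j -> c 0 i <> c 0 j) :
  for_generic_sym (fun A : 'M[R]_n =>
    has_exactly (multinomial n (block_sizes k n))
      (critical_point (isospectral c)
        (fun S : 'M[R[i]]_n => \tr (map_mx (real_complex R) A *m S)))).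
Proof.
have n_gt0 : (0 < n)%N.
  have /k_bounds/andP[k1 kn] := mem_tnth (Ordinal r_gt0) k.
  exact: leq_trans k1 kn.
have [F hF] := @polyfun_krylov R n (const_mx 1).
exists (fun A => A^T = A /\ mxeval F A = 0); split.
- exists (fun g => g = F) => A; split=> -[symA h]; split=> //; last exact: h.
  by move=> g ->.
- have [A symA detA] := @det_krylov_neq0 R n; exists A; split=> // -[_].
  by rewrite hF => /eqP; rewrite (negPf detA).
move=> A symA FA.
have detA : \det (krylov (const_mx 1) A) != 0.
  by apply/eqP => e; apply: FA; rewrite hF.
have [P [d [PP d_inj ->]]] := simple_spectrum symA detA.
pose point (t : seq R[i]) := spectral_mx P (\row_j nth 0 t j).
have point_entries e : point (entries e) = spectral_mx P e.
  congr spectral_mx; apply/rowP => j.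
  by rewrite mxE (nth_map j) ?size_enum_ord // nth_ord_enum.
have entries_row (t : seq R[i]) : size t = n ->
    entries (\row_(j < n) nth 0 t j) = t.
  move=> st; apply: (@eq_from_nth _ 0); rewrite size_map size_enum_ord // => i lt.
  by rewrite (nth_map (Ordinal lt)) ?size_enum_ord // mxE nth_enum_ord.
have size_perm t : t \in permutations (entries c) -> size t = n.
  by rewrite mem_permutations => /perm_size ->; rewrite size_map size_enum_ord.
exists (map point (permutations (entries c))); split.
- rewrite map_inj_in_uniq ?permutations_uniq // => s t.
  move=> /size_perm/entries_row es /size_perm/entries_row et.
  by move/(spectral_mx_inj PP) => e; rewrite -es -et e.
- rewrite size_map; apply: multinomial_permutations => // m.
  by case/k_bounds/andP.
move=> S; split=> [/mapP[t tc ->]|].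
  apply/critical_spectral_mxP => //; exists (\row_j nth 0 t j) => //.
  by rewrite entries_row ?(size_perm t) // -mem_permutations.
case/critical_spectral_mxP => // e ec ->; rewrite -point_entries.
by apply: map_f; rewrite mem_permutations.
Qed.
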